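(* Let $K$ be a field with $\operatorname{char}K\ne 2$, and let $$\mathrm{det}_3=\sum_{\sigma\in\Sigma_3}\operatorname{sgn}(\sigma)\,e_{\sigma(1)}\otimes e_{\sigma(2)}\otimes e_{\sigma(3)}\in K^3\otimes K^3\otimes K^3,$$ where $e_1,e_2,e_3$ is the standard basis of $K^3$ and $\Sigma_3$ is the symmetric group on $3$ letters. Then $\operatorname{brk}(\mathrm{det}_3)\ge 5$.
   Context: The tensor rank of $T\in K^a\otimes K^b\otimes K^c$ is the smallest $n$ such that $T$ is a sum of $n$ pure tensors $u\otimes v\otimes w$. Let $Z_n$ be the set of tensors of tensor rank $\le n$ and $\overline Z_n$ its Zariski closure (in the affine space $K^a\otimes K^b\otimes K^c$ over $K$). The border rank $\operatorname{brk}(T)$ is the smallest $n$ such that $T\in\overline Z_n$. *)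

(* Defs.v *)
From HB Require Import structures.
From mathcomp Require Import all_boot all_order all_fingroup all_algebra.
From mathcomp Require Import boolp classical_sets.
From mathcomp Require Import mpoly.

Set Implicit Arguments.
Unset Strict Implicit.
Unset Printing Implicit Defensive.

Import GRing.Theory.

Local Open Scope classical_set_scope.
Local Open Scope ring_scope.

Section ZariskiTopology.
Variables (K : fieldType) (I : finType).

(* The coordinates of the affine space K^I, numbered by [enum_val] so that
   they can be substituted for the variables of a polynomial. *)
Definition coords (x : {ffun I -> K}) : 'I_#|I| -> K := fun i => x (enum_val i).

Definition zero_locus (P : set {mpoly K[#|I|]}) : set {ffun I -> K} :=
  [set x | forall p, P p -> p.@[coords x] = 0].

Definition zariski_closed (C : set {ffun I -> K}) : Prop :=
  exists P : set {mpoly K[#|I|]}, C = zero_locus P.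

(* This is a closure in the set of K-points of the affine space, for the
   polynomials with coefficients in K; K may be finite. *)
Definition zariski_closure (Z : set {ffun I -> K}) : set {ffun I -> K} :=
  smallest zariski_closed Z.

Lemma sub_zariski_closure (Z : set {ffun I -> K}) : Z `<=` zariski_closure Z.
Proof. exact: sub_smallest. Qed.

End ZariskiTopology.

(* K^a (x) K^b (x) K^c, as the space of arrays of coordinates in the basis
   e_i (x) e_j (x) e_k. *)
Notation tensor K a b c := {ffun 'I_a * 'I_b * 'I_c -> K}.

Section TensorRank.
Variables (K : fieldType) (a b c : nat).
Implicit Types T : tensor K a b c.

Definition pure_tensor (u : 'rV[K]_a) (v : 'rV[K]_b) (w : 'rV[K]_c) :
    tensor K a b c :=
  [ffun ijk => u 0 ijk.1.1 * v 0 ijk.1.2 * w 0 ijk.2].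

Definition sum_of_pure (n : nat) T : Prop :=
  exists (u : 'I_n -> 'rV[K]_a) (v : 'I_n -> 'rV[K]_b) (w : 'I_n -> 'rV[K]_c),
    T = \sum_(l < n) pure_tensor (u l) (v l) (w l).

Lemma sum_of_pure_exists T : exists n, `[< sum_of_pure n T >].
Proof.
pose X : finType := ('I_a * 'I_b * 'I_c)%type.
exists #|X|; apply/asboolP.
exists (fun l => T (enum_val l) *: delta_mx 0 (enum_val l).1.1).
exists (fun l => delta_mx 0 (enum_val l).1.2).
exists (fun l => delta_mx 0 (enum_val l).2).
apply/ffunP => x; rewrite sum_ffunE (bigD1 (enum_rank x)) //= big1 ?addr0.
  by rewrite ffunE !mxE enum_rankK !eqxx /= !mulr1.
move=> l neq_l; rewrite ffunE !mxE /=.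
have: x != enum_val l by apply: contraNneq neq_l => ->; rewrite enum_valK.
case: x {neq_l} => [[i j] k]; case: (enum_val l) => [[i' j'] k'] /=.
rewrite !xpair_eqE.
rewrite !negb_and -orbA => /or3P[] /negbTE ->; by rewrite ?mulr0 ?mul0r.
Qed.

Definition tensor_rank T : nat := ex_minn (sum_of_pure_exists T).

Definition rank_le (n : nat) : set (tensor K a b c) :=
  [set T | (tensor_rank T <= n)%N].

Lemma closure_rank_le_exists T :
  exists n, `[< zariski_closure (rank_le n) T >].
Proof.
exists (tensor_rank T); apply/asboolP.
by apply: sub_zariski_closure; rewrite /rank_le /=.
Qed.

Definition border_rank T : nat := ex_minn (closure_rank_le_exists T).

End TensorRank.

Definition basis_vec (K : fieldType) (i : 'I_3) : 'rV[K]_3 := delta_mx 0 i.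

(* The indices 1, 2, 3 are shifted to 0, 1, 2; the parity of a permutation s is
   its coercion to bool. *)
Definition det3 (K : fieldType) : tensor K 3 3 3 :=
  [ffun ijk => \sum_(s : 'S_3) (-1) ^+ s *
    pure_tensor (basis_vec K (s (inord 0%N))) (basis_vec K (s (inord 1%N)))
                (basis_vec K (s (inord 2%N))) ijk].

(* Main.v *)
From HB Require Import structures.
Require Import Defs.
From mathcomp Require Import all_boot all_order all_fingroup all_algebra.
From mathcomp Require Import boolp classical_sets.
From mathcomp Require Import mpoly ring.

(** Strassen's equation separates [det3] from the tensors of rank at most 4.
    A tensor in K^3 (x) K^b (x) K^c gives a Koszul flattening

      K^3 (x) K^b -> (wedge^2 K^3) (x) K^c,   x (x) beta |-> t(beta) ^ x,

    where t(beta) in K^3 (x) K^c is the contraction of t with beta, a vector of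
    K^b seen as a linear form.  It depends linearly on t.  When
    t = u (x) v (x) w it is the tensor product of x |-> u ^ x, which kills u and
    so has rank at most 2, with a map of rank at most 1; hence a sum of n pure
    tensors has a flattening of rank at most 2n ([rank_koszul_sum]).  For
    b = c = 3 the flattening is a 9 x 9 matrix, so its determinant, a polynomial
    of degree 9 in the entries of t, vanishes on tensors of rank at most 4, and
    therefore on the Zariski closure of the set of these.

    At [det3] the flattening is, up to the usual identifications, the
    endomorphism X |-> tr(X) I - X^T of the 3 x 3 matrices ([koszul_map_det3]).
    If X is in its kernel, then taking traces gives 2 tr(X) = 0; so when 2 is
    invertible tr(X) = 0, X = 0, and the polynomial does not vanish at
    [det3]. *)

Set Implicit Arguments.
Unset Strict Implicit.
Unset Printing Implicit Defensive.

Import GRing.Theory.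

Local Open Scope ring_scope.

Section KoszulFlattening.
Variables (R : comNzRingType) (b c : nat).
Implicit Types (t : tensor R 3 b c) (X : 'M[R]_(3, b)).

(** The Koszul flattening, with wedge^2 R^3 identified with R^3 by the cross
    product: the indices of 'I_3 are added modulo 3, and coordinate k of a cross
    product x * y is x_(k+1) y_(k+2) - x_(k+2) y_(k+1). *)
Definition koszul_map t X : 'M[R]_(3, c) :=
  \matrix_(k, l) \sum_j (t (k + 1, j, l) * X (k + 2%:R) j
                         - t (k + 2%:R, j, l) * X (k + 1) j).

Lemma koszul_map_is_linear t : linear (koszul_map t).
Proof.
move=> a X Y; apply/matrixP => k l; rewrite !mxE mulr_sumr -big_split /=.
by apply: eq_bigr => j _; rewrite !mxE; ring.
Qed.

HB.instance Definition _ t :=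
  GRing.isLinear.Build R 'M[R]_(3, b) 'M[R]_(3, c) _ (koszul_map t)
    (koszul_map_is_linear t).

Lemma koszul_mapD t1 t2 X :
  koszul_map (t1 + t2) X = koszul_map t1 X + koszul_map t2 X.
Proof.
apply/matrixP => k l; rewrite !mxE -big_split /=.
by apply: eq_bigr => j _; rewrite !ffunE; ring.
Qed.

Lemma koszul_map0 X : koszul_map 0 X = 0.
Proof.
apply/matrixP => k l; rewrite !mxE big1 // => j _.
by rewrite !ffunE !mul0r subr0.
Qed.

Definition koszul_mx t : 'M[R]_(3 * b, 3 * c) := lin_mx (koszul_map t).

Lemma koszul_mxD : {morph koszul_mx : t1 t2 / t1 + t2}.
Proof.
by move=> t1 t2; apply/matrixP => p q; rewrite !mxE /= koszul_mapD linearD mxE.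
Qed.

Lemma koszul_mx0 : koszul_mx 0 = 0.
Proof. by apply/matrixP => p q; rewrite !mxE /= koszul_map0 linear0 mxE. Qed.

(** The matrix of y |-> u * y (cross product) on column vectors. *)
Definition cross_mx (u : 'rV[R]_3) : 'M[R]_3 :=
  \matrix_(k, i) (u 0 (k + 1) *+ (i == k + 2%:R)
                  - u 0 (k + 2%:R) *+ (i == k + 1)).

Lemma mul_cross_mx m (u : 'rV[R]_3) (Y : 'M[R]_(3, m)) k l :
  (cross_mx u *m Y) k l
    = u 0 (k + 1) * Y (k + 2%:R) l - u 0 (k + 2%:R) * Y (k + 1) l.
Proof.
rewrite mxE; under eq_bigr do rewrite mxE mulrBl.
rewrite sumrB; congr (_ - _).
  rewrite (bigD1 (k + 2%:R)) //= eqxx big1 ?addr0 // => i /negPf->.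
  by rewrite mul0r.
rewrite (bigD1 (k + 1)) //= eqxx big1 ?addr0 // => i /negPf->.
by rewrite mul0r.
Qed.

Lemma cross_mx_self (u : 'rV[R]_3) : cross_mx u *m u^T = 0.
Proof. by apply/matrixP => k l; rewrite mul_cross_mx !mxE ord1; ring. Qed.

(** Flattening a pure tensor gives the Kronecker product of [cross_mx u] and
    [v^T *m w]; the second factor has rank at most 1 over a field, so the rank
    is at most that of the cross product. *)
Lemma koszul_map_pure (u : 'rV[R]_3) (v : 'rV[R]_b) (w : 'rV[R]_c) X :
  koszul_map [ffun x => u 0 x.1.1 * v 0 x.1.2 * w 0 x.2] X
    = cross_mx u *m X *m v^T *m w.
Proof.
apply/matrixP => k l; rewrite !mxE big_ord1 !mxE mulr_suml.
by apply: eq_bigr => j _; rewrite mul_cross_mx !ffunE !mxE /=; ring.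
Qed.

End KoszulFlattening.

(** Base change makes the generic flattening, whose entries are
    polynomials, specialise to the flattening of each tensor. *)
Lemma map_koszul_mx (R S : comNzRingType) (f : {rmorphism R -> S}) b c
    (t : tensor R 3 b c) :
  map_mx f (koszul_mx t) = koszul_mx [ffun x => f (t x)].
Proof.
apply/matrixP => p q; rewrite !mxE /= -(map_delta_mx f) -map_vec_mx.
set X := vec_mx _; transitivity (map_mx f (mxvec (koszul_map t X)) 0 q).
  by rewrite mxE.
rewrite map_mxvec; congr (mxvec _ 0 q); apply/matrixP => k l.
rewrite !mxE rmorph_sum; apply: eq_bigr => j _.
by rewrite !ffunE !mxE rmorphB !rmorphM.
Qed.

Section Rank.
Variable K : fieldType.

(** u * u = 0, so a nonzero u spans a line in the kernel. *)
Lemma rank_cross_mx (u : 'rV[K]_3) : (\rank (cross_mx u) <= 2)%N.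
Proof.
have [->|nz_u] := eqVneq u 0.
  have -> : cross_mx 0 = 0 :> 'M[K]_3.
    by apply/matrixP => k i; rewrite !mxE !mul0rn subr0.
  by rewrite mxrank0.
have := mulmx0_rank_max (cross_mx_self u).
by rewrite mxrank_tr rank_rV nz_u addn1.
Qed.

(** Factoring [cross_mx u] through K^r, with r <= 2 its rank, factors the whole
    flattening through the r x 1 matrices. *)
Lemma rank_koszul_pure b c (u : 'rV[K]_3) (v : 'rV[K]_b) (w : 'rV[K]_c) :
  (\rank (koszul_mx (pure_tensor u v w)) <= 2)%N.
Proof.
pose C := cross_mx u.
have -> : koszul_mx (pure_tensor u v w)
    = lin_mx (mulmxr v^T \o mulmx (row_base C))
      *m lin_mx (mulmxr w \o mulmx (col_base C)).
  apply/row_matrixP => p; rewrite row_mul rowE mul_rV_lin [row _ _]rowE.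
  rewrite !mul_rV_lin /= mxvecK koszul_map_pure.
  by rewrite -[cross_mx u]mulmx_base -!mulmxA.
apply: leq_trans (mxrankM_maxl _ _) _; apply: leq_trans (rank_leq_col _) _.
by rewrite muln1 rank_cross_mx.
Qed.

Lemma rank_koszul_sum b c n (t : tensor K 3 b c) :
  sum_of_pure n t -> (\rank (koszul_mx t) <= 2 * n)%N.
Proof.
case=> u [v [w ->]].
rewrite (big_morph _ (@koszul_mxD K b c) (koszul_mx0 K b c)).
have -> : (2 * n = \sum_(l < n) 2)%N by rewrite sum_nat_const card_ord mulnC.
elim/big_rec2: _ => [|l r A _ leA]; first by rewrite mxrank0.
apply: leq_trans (mxrank_add _ _) _.
by rewrite leq_add ?rank_koszul_pure.
Qed.

Definition koszul_poly : {mpoly K[#|{: 'I_3 * 'I_3 * 'I_3}|]} :=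
  \det (koszul_mx [ffun x => 'X_(enum_rank x)]).

Lemma koszul_polyE (t : tensor K 3 3 3) :
  koszul_poly.@[coords t] = \det (koszul_mx t).
Proof.
rewrite -det_map_mx map_koszul_mx; congr (\det (koszul_mx _)).
apply/ffunP => x; rewrite 2!ffunE.
by apply: etrans (mevalXU _ _) _; rewrite /coords enum_rankK.
Qed.

(** The coordinates of [det3] are the Levi-Civita symbol, written with addition
    modulo 3 to match [koszul_map]. *)
Lemma det3E i j k :
  det3 K (i, j, k) = ((j == i + 1) && (k == i + 2%:R))%:R
                     - ((j == i + 2%:R) && (k == i + 1))%:R.
Proof.
(* The defining sum is the Leibniz formula for the matrix with rows
   e_i, e_j, e_k. *)
pose A : 'M[K]_3 := \matrix_(l, m) ([:: i; j; k]`_l == m)%:R.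
have -> : det3 K (i, j, k) = \det A.
  rewrite ffunE; apply: eq_bigr => s _; congr (_ * _).
  rewrite ffunE !big_ord_recl big_ord0 mulr1 !mxE /= mulrA.
  by congr (_ %:R * _ %:R * _ %:R); congr (_ == s _); apply: val_inj;
    rewrite /= inordK.
(* The second expansion acts on the 2 x 2 minors of the first. *)
rewrite (expand_det_row _ ord0) !big_ord_recl big_ord0 /cofactor.
rewrite !(expand_det_row _ ord0) !big_ord_recl !big_ord0 /cofactor !det_mx11.
rewrite !mxE /= {A}.
case: i j k => [[|[|[|//]]] ?] [[|[|[|//]]] ?] [[|[|[|//]]] ?].
all: rewrite /eq_op /=; ring.
Qed.

Lemma koszul_map_det3 X : koszul_map (det3 K) X = (\tr X)%:M - X^T.
Proof.
(* With indices in nat, the sums modulo 3 reduce to numerals and equal entries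
   of X become syntactically equal, as [ring] requires. *)
have [x Ex] : exists x : nat -> nat -> K, forall i j, X i j = x i j.
  by exists (fun i j => X (inord i) (inord j)) => i j; rewrite !inord_val.
apply/matrixP => k l; rewrite !mxE /mxtrace.
under eq_bigr do rewrite !det3E !Ex.
rewrite !big_ord_recl !big_ord0 !Ex.
case: k l => [[|[|[|//]]] ?] [[|[|[|//]]] ?].
all: rewrite /eq_op /=; ring.
Qed.

Lemma koszul_det3_unit : 2%:R != 0 :> K -> koszul_mx (det3 K) \in unitmx.
Proof.
move=> nz2; rewrite -row_free_unit; apply: inj_row_free => v.
rewrite mul_rV_lin /= koszul_map_det3 => /(canRL mxvecK); rewrite linear0.
set X := vec_mx v => /(canRL (subrK _)); rewrite add0r => trX.
have trX0 : \tr X = 0.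
  have: \tr X *+ 3 = \tr X by rewrite -mxtrace_scalar trX mxtrace_tr.
  move/eqP; rewrite mulrSr -subr_eq0 addrK -mulr_natr.
  by rewrite mulf_eq0 (negPf nz2) orbF => /eqP.
have X0 : X = 0 by rewrite -[X]trmxK -trX trX0 raddf0 linear0.
by rewrite -[v]vec_mxK -/X X0 linear0.
Qed.

End Rank.

Theorem lemma1p11 (K : fieldType) (charK : 2%N \notin [pchar K]%R) :
  (5 <= border_rank (det3 K))%N.
Proof.
rewrite /border_rank; case: ex_minnP => n /asboolP det3_closure _.
rewrite leqNgt; apply/negP => lt_n5.
have nz2 : 2%:R != 0 :> K by move: charK; rewrite inE.
have closed_poly : zariski_closed (zero_locus [set koszul_poly K]%classic).
  by exists [set koszul_poly K]%classic.
have rank_sub_locus :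
    (rank_le n `<=` zero_locus [set koszul_poly K])%classic.
  move=> t; rewrite /rank_le /= /tensor_rank.
  case: ex_minnP => r /asboolP t_sum _ le_rn _ ->.
  rewrite koszul_polyE; apply: contraTeq lt_n5 => nz_det.
  have: koszul_mx t \in unitmx by rewrite unitmxE unitfE.
  move/mxrank_unit => rank9; have := rank_koszul_sum t_sum.
  rewrite rank9 -leqNgt => le9.
  (* 9 <= 2 r is the same as 2 * 4 < 2 * r. *)
  by apply: leq_trans le_rn; rewrite -(@ltn_pmul2l 2).
have := det3_closure _ (conj closed_poly rank_sub_locus) _ erefl.
rewrite koszul_polyE => /eqP; apply/negP.
by rewrite -unitfE -unitmxE koszul_det3_unit.
Qed.
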